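(* Let $f\in L^2[0,1)$ satisfy the Lipschitz condition $|f(t)-f(s)|\le C|t-s|$ for all $s,t\in[0,1)$, with Lipschitz constant $C$. For $m=2^k$, $k=0,1,2,\dots$, and $h=1/m$, let $$e_m(t)=\Big|f(t)-\sum_{i=0}^{m-1}c_iw_i(t)\Big|,\qquad c_i=\int_0^1 f(s)w_i(s)\,ds,$$ where $w_i$ is the $i$-th Walsh function. Then $\|e_m(t)\|_2=O(h)$, i.e. there is a constant $M$, independent of $m$ and of $t\in[0,1)$, such that $\|e_m(t)\|_2\le Mh$ for all such $m$ and all $t\in[0,1)$.
   Context: $\|X\|_2=E(|X|^2)^{1/2}$ for a random variable $X$; here $f$ is deterministic, so $\|e_m(t)\|_2=e_m(t)$. Rademacher functions on $[0,1)$: $r_0=1$ and, for $i\ge1$, $r_i(t)=\operatorname{sgn}(\sin(2^i\pi t))$, taken right-continuous at the zeros of the sine, i.e. $r_i(t)=(-1)^{\lfloor 2^i t\rfloor}$. Walsh functions: $w_0=1$ and, for $n\ge1$ with binary expansion $n=b_q2^{q-1}+b_{q-1}2^{q-2}+\dots+b_12^0$ (where $q=\lfloor\log_2 n\rfloor+1$), $w_n(t)=r_q(t)^{b_q}r_{q-1}(t)^{b_{q-1}}\cdots r_1(t)^{b_1}$. *)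

(* Defs.v *)
From HB Require Import structures.
From mathcomp Require Import all_boot all_order all_algebra.
From mathcomp Require Import all_classical all_reals all_analysis.

Set Implicit Arguments.
Unset Strict Implicit.
Unset Printing Implicit Defensive.

Import Order.TTheory GRing.Theory Num.Theory.
Import numFieldNormedType.Exports.

Local Open Scope classical_set_scope.
Local Open Scope ring_scope.

(* The floor formula is sgn (sin (2^i pi t)), made right-continuous at the
   zeros of the sine. *)
Definition rademacher (R : realType) (i : nat) (t : R) : R :=
  if i == 0%N then 1 else (-1) ^ Num.floor (2 ^+ i * t).

(* [binary_digit n i] is b_i in n = \sum_(1 <= i) b_i * 2 ^ (i - 1): digits are
   numbered from 1, starting with the least significant one. *)
Definition binary_digit (n i : nat) : nat := ((n %/ 2 ^ i.-1) %% 2)%N.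

(* Paley ordering; [trunc_log 2 n] is floor (log_2 n) for n > 0. *)
Definition walsh (R : realType) (n : nat) (t : R) : R :=
  if n == 0%N then 1
  else \prod_(1 <= i < (trunc_log 2 n).+2) rademacher i t ^+ binary_digit n i.

Definition walsh_coef (R : realType) (f : R -> R) (i : nat) : R :=
  Rintegral (@lebesgue_measure R) `[0, 1[ (fun s => f s * walsh i s).

Definition walsh_error (R : realType) (f : R -> R) (m : nat) (t : R) : R :=
  `|f t - \sum_(0 <= i < m) walsh_coef f i * walsh i t|.

(* Main.v *)
Require Import Defs.
From HB Require Import structures.
From mathcomp Require Import all_boot all_order all_algebra.
From mathcomp Require Import all_classical all_reals all_analysis.
From mathcomp Require Import measurable_realfun.
From mathcomp Require Import zify ring lra.

(** The first 2^k Walsh functions are all the products of the Rademacher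
functions r_1, ..., r_k, so the kernel
<<  sum_(i < 2^k) w_i(s) w_i(t) = prod_(1 <= j <= k) (1 + r_j(s) r_j(t))  >>
vanishes as soon as s and t have different signs under one of the r_j, and is
2^k otherwise.  The signs r_1(t), ..., r_k(t) are the first k binary digits of
t, so the kernel is 2^k times the indicator of the dyadic interval of length
2^-k that contains t ([walsh_kernelE]).  Hence the Walsh partial sum at t is the
mean value of f over that interval ([walsh_partial_sum]).  All points of the
interval are within h = 2^-k of t, so a C-Lipschitz f differs from its mean
value there by at most C h ([walsh_error_le]): the constant M = C works, and
the bound holds pointwise.  The L^2 norm over the probability space is that of
a constant, which is the constant itself ([Lnorm2_cst]). *)

Set Implicit Arguments.
Unset Strict Implicit.
Unset Printing Implicit Defensive.

Import Order.TTheory GRing.Theory Num.Theory.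
Import numFieldNormedType.Exports.

Local Open Scope classical_set_scope.
Local Open Scope ring_scope.

(** * Walsh functions of index below a power of two *)

Lemma binary_digit_eq0 (n i : nat) : (n < 2 ^ i)%N -> binary_digit n i.+1 = 0%N.
Proof. by move=> lt_n; rewrite /binary_digit/= divn_small. Qed.

(** The definition stops the product at the leading digit of [n]; padding with
    zero digits gives all indices below 2^k the same range of factors. *)
Lemma walsh_prod (R : realType) (k n : nat) (t : R) : (n < 2 ^ k)%N ->
  walsh n t = \prod_(1 <= i < k.+1) rademacher i t ^+ binary_digit n i.
Proof.
move=> lt_n; rewrite /walsh; case: eqVneq => [->|n_neq0].
  by rewrite big1// => i _; rewrite /binary_digit div0n mod0n expr0.
have lt_n_log := trunc_log_ltn n (ltnSn 1).
have log_le : (trunc_log 2 n < k)%N.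
  have := leq_ltn_trans (trunc_logP (ltnSn 1) _) lt_n.
  by rewrite lt0n n_neq0 ltn_exp2l//; exact.
rewrite [RHS](big_cat_nat _ (n := (trunc_log 2 n).+2))//=.
rewrite [X in _ = _ * X]big1_seq ?mulr1// => i /andP[_].
rewrite mem_index_iota => /andP[log_lt _].
case: i log_lt => // i log_lt.
rewrite binary_digit_eq0 ?expr0//.
by apply: leq_trans lt_n_log _; rewrite leq_pexp2l.
Qed.

(** Adding 2^k to [i] sets the digit of rank k+1, which belongs to the factor
    r_(k+1), and leaves the lower digits alone.  This is the step that doubles
    the number of terms of the kernel. *)
Lemma walsh_addn (R : realType) (k i : nat) (t : R) : (i < 2 ^ k)%N ->
  walsh (2 ^ k + i) t = rademacher k.+1 t * walsh i t.
Proof.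
move=> lt_i; have lt_ki : (2 ^ k + i < 2 ^ k.+1)%N.
  by rewrite expnS mul2n -addnn ltn_add2l.
rewrite (walsh_prod _ lt_ki) (walsh_prod _ lt_i) big_nat_recr//= mulrC.
congr (_ * _).
  by rewrite /binary_digit/= divnDl ?dvdnn// divnn expn_gt0/= divn_small.
apply: eq_big_nat => j /andP[j_gt0 j_le]; congr (_ ^+ _).
case: j j_gt0 j_le => // j _; rewrite !ltnS => lt_jk.
have -> : (2 ^ k = 2 ^ (k - j.+1) * 2 * 2 ^ j)%N.
  by rewrite -mulnA -expnS -expnD subnK.
by rewrite /binary_digit/= divnMDl ?expn_gt0// modnMDl.
Qed.

(** * The kernel and the binary digits of its arguments *)

Lemma floor_double (R : realType) (x : R) :
  exists b : bool, Num.floor (2 * x) = 2 * Num.floor x + b%:Z.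
Proof.
have /andP[] := floor_itv x; rewrite intrD => le_x lt_x.
case: (ltP x ((Num.floor x)%:~R + 2^-1)) => [x_lo|x_hi].
  exists false; apply: floor_def; rewrite /= addr0 intrD intrM.
  by apply/andP; split; lra.
exists true; apply: floor_def; rewrite /= !intrD intrM.
by apply/andP; split; lra.
Qed.

(** The sign r_(i+1)(t) is the binary digit of rank i+1 of t, because floor is
    odd or even according to the digit it gains when its argument doubles. *)
Lemma rademacherS (R : realType) (i : nat) (t : R) :
  exists b : bool, Num.floor (2 ^+ i.+1 * t) = 2 * Num.floor (2 ^+ i * t) + b%:Z
    /\ rademacher i.+1 t = (-1) ^+ b.
Proof.
have [b eb] := floor_double (2 ^+ i * t); exists b.
rewrite mulrA -exprS in eb; split => //.
rewrite /rademacher/= eb expfzDr ?oppr_eq0 ?oner_eq0//.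
by rewrite -exprz_exp exprnP -[(-1) ^ 2]/((-1) ^+ 2) sqrrN expr1n exp1rz mul1r.
Qed.

(** Passing from k to k+1 multiplies the kernel by 1 + r_(k+1)(s) r_(k+1)(t),
    which is 2 or 0 according to whether the next binary digits of s and t
    agree. *)
Lemma walsh_kernelE (R : realType) (k : nat) (s t : R) :
  s \in `[0, 1[ -> t \in `[0, 1[ ->
  \sum_(0 <= i < 2 ^ k) walsh i s * walsh i t =
    (2 ^ k)%:R * (Num.floor (2 ^+ k * s) == Num.floor (2 ^+ k * t))%:R.
Proof.
rewrite !in_itv/= => s01 t01; elim: k => [|k IHk].
  rewrite expn0 big_nat1 /walsh/= !expr0 !mul1r.
  by rewrite (@floor_def _ s 0)// (@floor_def _ t 0)// eqxx.
rewrite expnS mul2n -addnn (big_cat_nat _ (n := 2 ^ k)) ?leq_addr//=.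
rewrite -[X in _ + \sum_(X <= _ < _) _]add0n big_addn addnK.
under [X in _ + X]eq_big_nat => i /andP[_ lt_i].
  rewrite addnC !walsh_addn// mulrACA; over.
rewrite -big_distrr/= IHk.
have [b [eb ->]] := rademacherS k s; have [c [ec ->]] := rademacherS k t.
rewrite eb ec natrD.
have [->|neq_st] := eqVneq (Num.floor (2 ^+ k * s)) (Num.floor (2 ^+ k * t)).
  rewrite (inj_eq (addrI _)).
  by case: b c {eb ec} => -[] /=; rewrite ?expr1 ?expr0 ?eqxx/=; ring.
rewrite (_ : (_ == _) = false); first by rewrite /=; ring.
by apply/negP => /eqP; case: b c {eb ec} => -[]/=; lia.
Qed.

(** * Measurability and boundedness of the Walsh functions *)

Lemma measurable_intr_floor (R : realType) (D : set R) : measurable D ->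
  measurable_fun D (fun x : R => (Num.floor x)%:~R : R).
Proof.
move=> mD; apply: nondecreasing_measurable => //.
by move=> x y xy; rewrite ler_int le_floor.
Qed.

Lemma measurable_rademacher (R : realType) (i : nat) :
  measurable_fun setT (@rademacher R i).
Proof.
case: i => [|i]; first exact: measurable_cst.
(* The digit of t of rank i+1 is floor (2^(i+1) t) - 2 floor (2^i t), and a
   sign is 1 minus twice its digit. *)
pose g j (t : R) : R := (Num.floor (2 ^+ j * t))%:~R.
have mg j : measurable_fun setT (g j).
  apply: (measurableT_comp (measurable_intr_floor measurableT)).
  exact: measurable_funM.
have -> : @rademacher R i.+1 = fun t => 1 - 2 * (g i.+1 t - 2 * g i t).
  apply/funext => t; have [b [eb ->]] := rademacherS i t.
  rewrite /g eb intrD intrM; case: b {eb} => /=;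
    rewrite ?expr1 ?expr0 ?mulr1z ?mulr0z; ring.
apply: measurable_funB => //; apply: measurable_funM => //.
by apply: measurable_funB => //; exact: measurable_funM.
Qed.

Lemma measurable_walsh (R : realType) (n : nat) :
  measurable_fun setT (@walsh R n).
Proof.
rewrite /walsh; case: eqP => _; first exact: measurable_cst.
apply: measurable_prod => i _; apply: measurable_funX.
exact: measurable_rademacher.
Qed.

Lemma normr_rademacher (R : realType) (i : nat) (t : R) : `|rademacher i t| = 1.
Proof.
case: i => [|i]; first by rewrite /rademacher normr1.
by have [b [_ ->]] := rademacherS i t; rewrite normr_sign.
Qed.

Lemma normr_walsh (R : realType) (n : nat) (t : R) : `|walsh n t| = 1.
Proof.
rewrite /walsh; case: eqP => _; first exact: normr1.
rewrite normr_prod big1// => i _.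
by rewrite normrX normr_rademacher expr1n.
Qed.

(** * Dyadic intervals *)

Definition dyadic_cell (R : realType) (k : nat) (t : R) : set R :=
  let a : R := (Num.floor (2 ^+ k * t))%:~R in `[a / 2 ^+ k, (a + 1) / 2 ^+ k[.

Lemma dyadic_cellP (R : realType) (k : nat) (s t : R) :
  dyadic_cell k t s <-> Num.floor (2 ^+ k * s) = Num.floor (2 ^+ k * t).
Proof.
have k_gt0 : 0 < 2 ^+ k :> R by rewrite exprn_gt0.
rewrite /dyadic_cell/= in_itv/= ler_pdivrMr// ltr_pdivlMr// [s * _]mulrC.
split => [st|<-]; first by apply: floor_def; rewrite intrD.
by have := floor_itv (2 ^+ k * s); rewrite intrD.
Qed.

Lemma measurable_dyadic_cell (R : realType) (k : nat) (t : R) :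
  measurable (dyadic_cell k t).
Proof. exact: measurable_itv. Qed.

Lemma dyadic_cell_dist (R : realType) (k : nat) (s t : R) :
  dyadic_cell k t s -> `|t - s| <= (2 ^+ k)^-1.
Proof.
have := (dyadic_cellP k t t).2 erefl.
rewrite /dyadic_cell/= !in_itv/= !mulrDl mul1r => /andP[t1 t2] /andP[s1 s2].
by rewrite ler_norml; apply/andP; split; lra.
Qed.

Lemma lebesgue_measure_dyadic_cell (R : realType) (k : nat) (t : R) :
  lebesgue_measure (dyadic_cell k t) = ((2 ^+ k)^-1)%:E.
Proof.
have k_gt0 : 0 < 2 ^+ k :> R by rewrite exprn_gt0.
rewrite lebesgue_measure_itv/= lte_fin ltr_pM2r ?invr_gt0// ltrDl ltr01.
by rewrite -EFinB; congr EFin; field; rewrite gt_eqF.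
Qed.

Lemma dyadic_cell_sub (R : realType) (k : nat) (t : R) :
  t \in `[0, 1[ -> dyadic_cell k t `<=` `[0, 1[.
Proof.
have k_gt0 : 0 < 2 ^+ k :> R by rewrite exprn_gt0.
rewrite in_itv/= => /andP[t_ge0 t_lt1] s /dyadic_cellP st.
have s_ge0 : 0 <= 2 ^+ k * s.
  by rewrite -floor_ge0 st floor_ge0 mulr_ge0// ltW.
have s_lt : 2 ^+ k * s < 2 ^+ k.
  rewrite -[X in _ < X]natrX -[X in _ < X]mulrz_nat -floor_lt_int st.
  by rewrite floor_lt_int mulrz_nat natrX -[X in _ < X]mulr1 ltr_pM2l.
rewrite pmulr_rge0// in s_ge0.
by rewrite /= in_itv/= s_ge0/=; rewrite -(ltr_pM2l k_gt0) mulr1.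
Qed.

(** * Walsh partial sums as mean values *)

Lemma integrable_mul_walsh (R : realType) (f : R -> R) (n : nat) :
  (@lebesgue_measure R).-integrable `[0, 1[ (EFin \o f) ->
  (@lebesgue_measure R).-integrable `[0, 1[ (EFin \o (fun s => f s * walsh n s)).
Proof.
move=> if1; apply: (integrableMl _ if1) => //.
  by apply: measurable_funTS; exact: measurable_walsh.
by exists 1; split => // x x_gt1 s _ /=; rewrite normr_walsh ltW.
Qed.

Lemma Rintegral_sum (R : realType) (d : measure_display) (T : measurableType d)
    (mu : {measure set T -> \bar R}) (D : set T) (I : Type) (r : seq I)
    (h : I -> T -> R) : measurable D ->
  (forall i, mu.-integrable D (EFin \o h i)) ->
  \int[mu]_(x in D) (\sum_(i <- r) h i x) = \sum_(i <- r) \int[mu]_(x in D) h i x.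
Proof.
move=> mD ih; elim: r => [|i r IHr].
  by under eq_Rintegral do rewrite big_nil; rewrite Rintegral_cst// mul0r big_nil.
rewrite big_cons -IHr -RintegralD//; last first.
  rewrite (_ : _ \o _ = fun x => \sum_(j <- r) (h j x)%:E)%E.
    by apply: integrable_sum => // j _; exact: ih.
  by apply/funext => x /=; rewrite sumEFin.
by apply: eq_Rintegral => x _; rewrite big_cons.
Qed.

(** The coefficients are integrals, so exchanging sum and integral turns the
    partial sum into the integral of [f] against the kernel, that is 2^k times
    an indicator; as 2^k is the inverse of the length of the cell, the right
    side is the mean value of [f] over it. *)
Lemma walsh_partial_sum (R : realType) (f : R -> R) (k : nat) (t : R) :
  (@lebesgue_measure R).-integrable `[0, 1[ (EFin \o f) -> t \in `[0, 1[ ->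
  \sum_(0 <= i < 2 ^ k) walsh_coef f i * walsh i t =
    2 ^+ k * \int[lebesgue_measure]_(s in dyadic_cell k t) f s.
Proof.
move=> if1 t01; have mI := measurable_dyadic_cell k t.
have sI := @dyadic_cell_sub R k t t01.
rewrite -RintegralZl//; last exact: integrableS if1.
under eq_bigr => i _.
  rewrite /walsh_coef -RintegralZr//; last exact: integrable_mul_walsh.
  over.
rewrite -Rintegral_sum//; last first.
  move=> i; apply: (integrableMl _ (integrable_mul_walsh i if1)) => //.
  by exists `|walsh i t|; split; [exact: num_real | move=> x /ltW le_x s _].
rewrite -(setIidr sI) Rintegral_mkcondr.
apply: eq_Rintegral => s /set_mem s01.
under eq_bigr do rewrite -mulrA.
rewrite -big_distrr/= walsh_kernelE// natrX mulrCA mulrA patchE.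
case: eqP => [/dyadic_cellP st|/dyadic_cellP st].
  by rewrite mem_set// mulr1.
by rewrite memNset// mulr0.
Qed.

(** Writing [f t] as the mean value of a constant over the cell bounds the error
    by the mean value of [`|f t - f s|], and s is within 2^-k of t there. *)
Lemma walsh_error_le (R : realType) (f : R -> R) (C : R) (k : nat) (t : R) :
  (@lebesgue_measure R).-integrable `[0, 1[ (EFin \o f) ->
  (forall s : R, s \in `[0, 1[ -> `|f t - f s| <= C * `|t - s|) -> 0 <= C ->
  t \in `[0, 1[ -> walsh_error f (2 ^ k) t <= C / 2 ^+ k.
Proof.
move=> if1 lipf C_ge0 t01.
have k_gt0 : 0 < 2 ^+ k :> R by rewrite exprn_gt0.
have mI := measurable_dyadic_cell k t.
have muI := lebesgue_measure_dyadic_cell k t.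
have sI := @dyadic_cell_sub R k t t01.
have icst c : (@lebesgue_measure R).-integrable (dyadic_cell k t)
    (EFin \o fun=> c : R).
  apply: measurable_bounded_integrable => //.
  - by rewrite /= muI ltry.
  - by exists `|c|; split; [exact: num_real | move=> x /ltW le_x s _].
have ifI : (@lebesgue_measure R).-integrable (dyadic_cell k t) (EFin \o f).
  exact: integrableS if1.
have idf : (@lebesgue_measure R).-integrable (dyadic_cell k t)
    (EFin \o (fun s => f t - f s)).
  exact: (integrableB _ (icst (f t)) ifI).
rewrite /walsh_error walsh_partial_sum//.
have -> : f t = 2 ^+ k * \int[lebesgue_measure]_(s in dyadic_cell k t) f t.
  by rewrite Rintegral_cst//= muI/=; field; rewrite gt_eqF.
rewrite -mulrBr -RintegralB// normrM gtr0_norm// -ler_pdivlMl//.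
apply: le_trans (le_normr_Rintegral _ idf) _ => //.
rewrite [leRHS](_ : _ = \int[lebesgue_measure]_(s in dyadic_cell k t) (C / 2 ^+ k)).
  apply: le_Rintegral => //; first exact: integrable_norm.
  move=> s Is; apply: le_trans (lipf _ (sI _ Is)) _.
  by rewrite ler_wpM2l// dyadic_cell_dist.
by rewrite Rintegral_cst//= muI/= mulrC.
Qed.

(** On the bounded interval [0, 1[ a Lipschitz function is bounded by
    [`|f 0| + C], so measurability suffices for integrability. *)
Lemma lipschitz_integrable (R : realType) (f : R -> R) (C : R) :
  measurable_fun (`[0, 1[ : set R) f ->
  (forall s t : R, s \in `[0, 1[ -> t \in `[0, 1[ ->
     `|f t - f s| <= C * `|t - s|) -> 0 <= C ->
  (@lebesgue_measure R).-integrable `[0, 1[ (EFin \o f).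
Proof.
move=> mf lipf C_ge0; apply: measurable_bounded_integrable => //.
  by rewrite /= lebesgue_measure_itv/= lte_fin ltr01 -EFinB ltry.
exists (`|f 0| + C); split; first exact: num_real.
move=> x /ltW le_x s /= s01; apply: le_trans le_x.
have zero01 : (0 : R) \in `[0, 1[ by rewrite in_itv/= lexx ltr01.
rewrite -[f s](subrK (f 0)) addrC; apply: le_trans (ler_normD _ _) _.
rewrite lerD2l; apply: le_trans (lipf _ _ zero01 s01) _.
move: s01; rewrite in_itv/= subr0 => /andP[s_ge0 s_lt1].
by rewrite ger0_norm// ler_piMr// ltW.
Qed.

Lemma Lnorm2_cst (R : realType) (d : measure_display) (T : measurableType d)
    (P : probability T R) (c : R) : 0 <= c ->
  'N[P]_(2%:E)[EFin \o cst c]%E = c%:E.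
Proof.
move=> c_ge0; rewrite unlock /Lnorm/=.
rewrite integral_cst//= probability_setT mule1 ger0_norm//.
by rewrite poweR_EFin -powRrM mulfV// powRr1.
Qed.

(** * The error bound *)

Theorem theorem5p1 (R : realType)
    (d : measure_display) (Omega : measurableType d) (P : probability Omega R)
    (f : R -> R) (C : R)
    (f_L2 : f \_ `[0, 1[ \in Lfun (@lebesgue_measure R) 2%:E)
    (f_lipschitz : forall s t : R, s \in `[0, 1[ -> t \in `[0, 1[ ->
       `|f t - f s| <= C * `|t - s|) :
  exists M : R, forall (k m : nat) (h : R), m = (2 ^ k)%N -> h = 1 / m%:R ->
    forall t : R, t \in `[0, 1[ ->
      ('N[P]_(2%:E)[EFin \o cst (walsh_error f m t)] <= (M * h)%:E)%E.
Proof.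
(* The Lipschitz inequality between the distinct points 0 and 1/2 forces this. *)
have C_ge0 : 0 <= C.
  have half_gt0 : 0 < 2^-1 :> R by rewrite invr_gt0.
  have lip := f_lipschitz 0 2^-1.
  rewrite -(pmulr_lge0 _ half_gt0) -[2^-1 in X in _ <= X]gtr0_norm//.
  rewrite -[2^-1 in X in _ <= X]subr0.
  by apply: le_trans (lip _ _) => //; rewrite in_itv/=; apply/andP; split; lra.
have mf : measurable_fun (`[0, 1[ : set R) f.
  apply/(measurable_restrictT _ (measurable_itv _)).
  by move: f_L2 => /andP[]; rewrite inE.
have if1 := lipschitz_integrable mf f_lipschitz C_ge0.
exists C => k m h -> -> t t01.
rewrite Lnorm2_cst ?normr_ge0// lee_fin div1r natrX.
by apply: walsh_error_le => // s s01; exact: f_lipschitz.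
Qed.
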